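(* Let $A$ be a unital commutative $\mathbb{R}$-algebra and let $M$ be an Archimedean quadratic module of $A$. For $a\in A$ put $\|a\|_M:=\inf\{r\in\mathbb{R} : r+a\in M \text{ and } r-a\in M\}$. Then $\|\cdot\|_M$ is a submultiplicative seminorm on $A$.
   Context: Real numbers are regarded as elements of $A$ via $r\mapsto r\cdot 1$. A cone of $A$ is a set $C\subseteq A$ with $C+C\subseteq C$ and $\mathbb{R}_{\ge0}\cdot C\subseteq C$. A quadratic module of $A$ is a cone $M$ containing $0$ and $1$ which is closed under multiplication by sums of squares, i.e. $\sum A^2\cdot M\subseteq M$. A cone $C$ is Archimedean if for every $a\in A$ there exists $r\in\mathbb{R}_{\ge0}$ such that $r+a\in C$ and $r-a\in C$. A seminorm $\rho$ on $A$ is submultiplicative if $\rho(ab)\le\rho(a)\rho(b)$ for all $a,b\in A$. *)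

(* Defs.v *)
From mathcomp Require Import all_boot all_order all_algebra.
From mathcomp Require Import all_classical all_reals.

Set Implicit Arguments.
Unset Strict Implicit.
Unset Printing Implicit Defensive.

Import Order.TTheory GRing.Theory Num.Theory.

Local Open Scope classical_set_scope.
Local Open Scope ring_scope.

Section Defs.
Context {R : realType} {A : comAlgType R}.

Definition cone (C : set A) : Prop :=
  (forall a b : A, C a -> C b -> C (a + b)) /\
  (forall (r : R) (a : A), 0 <= r -> C a -> C (r *: a)).

Definition sum_of_squares : set A :=
  [set s | exists t : seq A, s = \sum_(a <- t) a ^+ 2].

Definition quadratic_module (M : set A) : Prop :=
  [/\ cone M, M 0, M 1
    & forall s a : A, sum_of_squares s -> M a -> M (s * a)].

Definition archimedean (C : set A) : Prop :=
  forall a : A, exists r : R, [/\ 0 <= r, C (r%:A + a) & C (r%:A - a)].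

Definition mbounds (M : set A) (a : A) : set R :=
  [set r | M (r%:A + a) /\ M (r%:A - a)].

(* The library's [inf] is total, with value 0 on sets that have no infimum;
   [has_inf_mbounds] below shows that, for an Archimedean quadratic module M,
   this convention matters only if -1 lies in M (i.e. M is the whole of A,
   every [mbounds M a] is the whole real line, and mnorm M = 0). *)
Definition mnorm (M : set A) (a : A) : R := inf (mbounds M a).

Definition seminorm (rho : A -> R) : Prop :=
  [/\ forall a : A, 0 <= rho a,
      forall a b : A, rho (a + b) <= rho a + rho b
    & forall (r : R) (a : A), rho (r *: a) = `|r| * rho a].

Definition submultiplicative (rho : A -> R) : Prop :=
  forall a b : A, rho (a * b) <= rho a * rho b.

Lemma has_inf_mbounds (M : set A) (a : A) :
  quadratic_module M -> archimedean M -> ~ M (- 1) -> has_inf (mbounds M a).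
Proof.
move=> [[MD MZ] _ _ _] archM MN1; split.
  by have [r [_ Mra Mrb]] := archM a; exists r.
exists 0 => r [Mra Mrb]; rewrite leNgt; apply/negP => r0; apply: MN1.
have M2r : M ((r *+ 2)%:A).
  by have := MD _ _ Mra Mrb; rewrite addrACA subrr addr0 -mulr2n -scalerMnl.
have r20 : r *+ 2 < 0 by rewrite pmulrn_llt0.
have := MZ (- (r *+ 2)^-1) _ _ M2r.
rewrite scalerA mulNr mulVf ?lt_eqF// scaleN1r; apply.
by rewrite oppr_ge0 invr_le0 ltW.
Qed.

End Defs.

(* Main.v *)
(* If r ± a lie in M, with r > 0, then so does r² - a², because
   2r(r² - a²) = (r + a)²(r - a) + (r - a)²(r + a); conversely
   2r(r ± a) = (r ± a)² + (r² - a²).  Submultiplicativity follows from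
   r²s² - a²b² = s²(r² - a²) + a²(s² - b²). *)
Require Import Defs.
From mathcomp Require Import all_boot all_order all_algebra.
From mathcomp Require Import all_classical all_reals.
From mathcomp Require Import ring.

Set Implicit Arguments.
Unset Strict Implicit.
Unset Printing Implicit Defensive.

Import Order.TTheory GRing.Theory Num.Theory.

Local Open Scope classical_set_scope.
Local Open Scope ring_scope.

(** Serves to replace a norm [x] in a product by strictly larger bounds [r], one factor at a time.
    For [s = 0] the single instance [r = x + 1] suffices; otherwise divide by [s] and let [r] tend
    to [x]. *)
Lemma le_mulr_gtP (R : realFieldType) (x p s : R) : 0 <= s ->
  (forall r, x < r -> p <= r * s) -> p <= x * s.
Proof.
rewrite le_eqVlt => /predU1P[<- h|s0 h].
  by have := h (x + 1); rewrite !mulr0; apply; rewrite ltrDl.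
rewrite -ler_pdivrMr//; apply/ler_addgt0Pr => e e0.
by rewrite ler_pdivrMr// h// ltrDl.
Qed.

Section QuadraticModule.
Context {R : realType} {A : comAlgType R} (M : set A).
Hypothesis qM : quadratic_module M.

Let MD a b : M a -> M b -> M (a + b).
Proof. by case: qM => -[+ _] _ _ _; apply. Qed.

Let MZ (r : R) a : 0 <= r -> M a -> M (r *: a).
Proof. by case: qM => -[_ +] _ _ _; apply. Qed.

Let M1 : M 1. Proof. by case: qM. Qed.

Lemma quadratic_module_sqrM a b : M b -> M (a ^+ 2 * b).
Proof.
by case: qM => _ _ _; apply; exists [:: a]; rewrite big_seq1.
Qed.

Lemma quadratic_module_sqr a : M (a ^+ 2).
Proof. by rewrite -[_ ^+ 2]mulr1; apply: quadratic_module_sqrM. Qed.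

(** The constant [s - r] is a nonnegative multiple of 1, hence in [M], and can be added to
    [r ± a]. *)
Lemma mboundsW r s a : r <= s -> mbounds M a r -> mbounds M a s.
Proof.
move=> rs [Mp Mm].
have Msr : M ((s - r)%:A) by apply: MZ => //; rewrite subr_ge0.
by split; [have := MD Msr Mp | have := MD Msr Mm];
  rewrite addrA -scalerDl subrK.
Qed.

Lemma mboundsD r s a b :
  mbounds M a r -> mbounds M b s -> mbounds M (a + b) (r + s).
Proof.
move=> [Mpa Mma] [Mpb Mmb]; split; rewrite scalerDl.
  by rewrite addrACA; apply: MD.
by rewrite opprD addrACA; apply: MD.
Qed.

Lemma mboundsZ (c r : R) a : mbounds M a r -> mbounds M (c *: a) (`|c| * r).
Proof.
move=> [Mp Mm]; have [c0|c0] := ger0P c.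
  by split; rewrite -scalerA -?scalerN -scalerDr; apply: MZ.
have Nc0 : 0 <= - c by rewrite oppr_ge0 ltW.
(* For negative [c] the outer sign exchanges the two membership conditions. *)
rewrite -[c *: a]opprK -scaleNr.
by split; rewrite ?opprK -scalerA -?scalerN -scalerDr; apply: MZ.
Qed.

Lemma mbounds_sqrP (r : R) a : 0 < r ->
  mbounds M a r <-> M ((r ^+ 2)%:A - a ^+ 2).
Proof.
move=> r0; have r2 : 0 <= (r *+ 2)^-1 by rewrite invr_ge0 mulrn_wge0// ltW.
(* Membership in [M] is tested after scaling by [2r > 0], where the identities need no division. *)
have rK b : b = (r *+ 2)^-1 *: ((r *+ 2) *: b).
  by rewrite scalerA mulVf ?scale1r// gt_eqF// pmulrn_lgt0.
have tE b : (r *+ 2) *: b = r%:A * b *+ 2 by rewrite -scalerMnl mulr_algl.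
have sE : (r ^+ 2)%:A = r%:A ^+ 2 :> A.
  by rewrite expr2 -scalerA -mulr_algl -expr2.
split=> [[Mp Mm]|Mr].
  rewrite [X in M X]rK; apply: MZ => //; rewrite tE sE.
  have := MD (quadratic_module_sqrM (r%:A + a) Mm)
             (quadratic_module_sqrM (r%:A - a) Mp).
  by congr M; ring.
split; rewrite [X in M X]rK; apply: MZ => //; rewrite tE.
  have := MD (quadratic_module_sqr (r%:A + a)) Mr.
  by rewrite sE; congr M; ring.
have := MD (quadratic_module_sqr (r%:A - a)) Mr.
by rewrite sE; congr M; ring.
Qed.

Lemma mboundsM (r s : R) a b : 0 < r -> 0 < s ->
  mbounds M a r -> mbounds M b s -> mbounds M (a * b) (r * s).
Proof.
move=> r0 s0 /(mbounds_sqrP _ r0) Ma /(mbounds_sqrP _ s0) Mb.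
apply/mbounds_sqrP; first exact: mulr_gt0.
have := MD (MZ (sqr_ge0 s) Ma) (quadratic_module_sqrM a Mb).
congr M; rewrite !exprMn scalerBr scalerA mulrBr [s ^+ 2 * _]mulrC.
by rewrite -[_ *: a ^+ 2]mulr_algr addrA subrK.
Qed.

Hypothesis archM : archimedean M.

Lemma mbounds_setT a : M (- 1) -> mbounds M a = setT.
Proof.
move=> MN1; apply/seteqP; split=> // r _; have [t [t0 Mp Mm]] := archM a.
(* The number [-|r| <= r] is written so that it arises from the bound [t] by adding a nonnegative
   multiple of -1. *)
apply: (@mboundsW (t - (t + `|r|)));
  first by rewrite opprD addNKr lerNl -normrN ler_norm.
have Mtr : M (- (t + `|r|)%:A).
  by rewrite -scalerN; apply: MZ; rewrite ?addr_ge0.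
by split; rewrite scalerBl addrAC; apply: MD.
Qed.

Lemma mnormT a : M (- 1) -> mnorm M a = 0.
Proof.
(* The whole line has no lower bound, as [x - 1 < x] shows, so [inf] takes its default value 0. *)
move=> MN1; rewrite /mnorm mbounds_setT// inf_out// => -[_ [x /(_ (x - 1) I)]].
by rewrite lerBrDl gerDr ler10.
Qed.

(** The assumption [0 <= r] handles the degenerate case -1 in [M], where negative bounds exist but
    the norm is 0. *)
Lemma mnorm_le r a : 0 <= r -> mbounds M a r -> mnorm M a <= r.
Proof.
move=> r0 Mr; have [MN1|MN1] := pselect (M (- 1)); first by rewrite mnormT.
by apply: ge_inf => //; case: (has_inf_mbounds a qM archM MN1).
Qed.

(** Some bound lies strictly below [r], and bounds are upward closed. The inequality is strict
    because [M] is not assumed closed, so the infimum may fail to be a bound. *)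
Lemma mbounds_gt_mnorm r a : mnorm M a < r -> mbounds M a r.
Proof.
move=> /inf_lt; case=> [|s Ms /ltW sr]; last exact: mboundsW sr Ms.
by have [t [_ Mp Mm]] := archM a; exists t.
Qed.

Lemma mnorm_ge0 a : 0 <= mnorm M a.
Proof.
have [MN1|MN1] := pselect (M (- 1)); first by rewrite mnormT.
have [a0 _] := has_inf_mbounds a qM archM MN1.
apply: lb_le_inf => // r Mr; rewrite leNgt; apply/negP => r0.
have [Mp Mm] := Mr; apply: MN1.
(* A negative bound [r] would put [2r], and hence -1, into [M]. *)
have -> : -1 = (- (r *+ 2)^-1) *: ((r%:A + a) + (r%:A - a)) :> A.
  rewrite addrACA subrr addr0 -mulr2n scalerMnl scalerA mulNr mulVf ?scaleN1r//.
  by rewrite lt_eqF// pmulrn_llt0.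
by apply: MZ; [rewrite oppr_ge0 invr_le0 ltW// pmulrn_llt0 | exact: MD].
Qed.

Lemma mnormD a b : mnorm M (a + b) <= mnorm M a + mnorm M b.
Proof.
apply/ler_addgt0Pr => e e0; rewrite (splitr e) addrACA.
apply: mnorm_le; first by rewrite !addr_ge0 ?mnorm_ge0 ?divr_ge0 ?ltW.
by apply: mboundsD; apply: mbounds_gt_mnorm; rewrite ltrDl divr_gt0.
Qed.

Lemma mnormZ_le (c : R) a : mnorm M (c *: a) <= `|c| * mnorm M a.
Proof.
rewrite mulrC; apply: le_mulr_gtP => // r ar; rewrite mulrC.
apply: mnorm_le; last exact/mboundsZ/mbounds_gt_mnorm.
by rewrite mulr_ge0// (le_trans (mnorm_ge0 a))// ltW.
Qed.

Lemma mnormZ (c : R) a : mnorm M (c *: a) = `|c| * mnorm M a.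
Proof.
apply/eqP; rewrite eq_le mnormZ_le/=; have [->|c0] := eqVneq c 0.
  by rewrite normr0 mul0r mnorm_ge0.
(* The reverse inequality is [mnormZ_le] for the scalar [c^-1] and the element [c *: a]. *)
rewrite -ler_pdivlMl ?normr_gt0// -normfV.
by rewrite -{1}[a](scalerK c0) mnormZ_le.
Qed.

(** Any [r], [s] strictly above the two norms are positive bounds, so [mboundsM] applies; then both
    descend to the norms. *)
Lemma mnormM a b : mnorm M (a * b) <= mnorm M a * mnorm M b.
Proof.
apply: le_mulr_gtP => [|r ar]; first exact: mnorm_ge0.
have r0 : 0 < r := le_lt_trans (mnorm_ge0 a) ar.
rewrite [r * _]mulrC; apply: le_mulr_gtP => [|s bs]; first exact: ltW.
have s0 : 0 < s := le_lt_trans (mnorm_ge0 b) bs.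
rewrite [s * r]mulrC; apply: mnorm_le; first by rewrite mulr_ge0 ?ltW.
by apply: mboundsM => //; apply: mbounds_gt_mnorm.
Qed.

End QuadraticModule.

Theorem proposition3p4 (R : realType) (A : comAlgType R) (M : set A) :
  quadratic_module M -> archimedean M ->
  seminorm (mnorm M) /\ submultiplicative (mnorm M).
Proof.
move=> qM archM; split; last exact: mnormM.
by split; [exact: mnorm_ge0 | exact: mnormD | exact: mnormZ].
Qed.
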